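(* Let $n\ge 2$, let $K\in\mathcal{C}^n$ and let $p\in\mathbb{R}$ be such that $p\ge 0$ or $p<-n$. Then for all $k\in\mathbb{N}$ and all integers $m\ge 0$: (i) $\mathcal{W}^p_{m,k}$ and $\mathcal{V}^p_k$ are homogeneous of degree $n\frac{n-p}{n+p}-k$, i.e. $\mathcal{W}^p_{m,k}(aK)=a^{n\frac{n-p}{n+p}-k}\mathcal{W}^p_{m,k}(K)$ and $\mathcal{V}^p_k(aK)=a^{n\frac{n-p}{n+p}-k}\mathcal{V}^p_k(K)$ for every $a>0$; (ii) $\mathcal{W}^p_{m,k}$ and $\mathcal{V}^p_k$ are invariant under rotations and reflections, i.e. $\mathcal{W}^p_{m,k}(TK)=\mathcal{W}^p_{m,k}(K)$ and $\mathcal{V}^p_k(TK)=\mathcal{V}^p_k(K)$ for every rotation or reflection $T$ of $\mathbb{R}^n$ (linear, fixing the origin).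
   Context: $\mathbb{N}=\{1,2,\dots\}$. A convex body is a compact convex subset of $\mathbb{R}^n$ with nonempty interior; $\mathcal{K}^n_o$ is the set of convex bodies in $\mathbb{R}^n$ containing the origin in their interior. For a convex body $K$ and $x\in\partial K$, $N(x)$ is the outer unit normal of $K$ at $x$ (unique for $\mathcal{H}^{n-1}$-almost all $x$), $k_1(x),\dots,k_{n-1}(x)$ are the (generalized) principal curvatures, which exist for $\mathcal{H}^{n-1}$-almost all $x\in\partial K$, and $H_j=\binom{n-1}{j}^{-1}\sum_{1\le i_1<\dots<i_j\le n-1}k_{i_1}\cdots k_{i_j}$ for $1\le j\le n-1$, $H_0=1$. $\mathcal{H}^{n-1}$ is the surface area measure on $\partial K$. $B^n_2(y,r)$ is the closed Euclidean ball with center $y$ and radius $r$. $K$ admits an inner rolling ball if there is $r>0$ with $B^n_2(x-rN(x),r)\subseteq K$ for every $x\in\partial K$, and an outer rolling ball if there is $R>0$ with $K\subseteq B^n_2(x-RN(x),R)$ for every $x\in\partial K$ (where $N(x)$ is an outer unit normal at $x$). $\mathcal{C}^n$ is the set of $K\in\mathcal{K}^n_o$ admitting both an inner and an outer rolling ball. For $\alpha\in\mathbb{R}$: $\binom{\alpha}{0}=1$, $\binom{\alpha}{k}=\frac{\alpha(\alpha-1)\cdots(\alpha-k+1)}{k!}$ for integers $k>0$, and $\binom{\alpha}{k}=0$ for $k<0$. For non-negative integers $i_1,\dots,i_{n-1}$ with $i_1+2i_2+\dots+(n-1)i_{n-1}=m$ put $$c(n,p,i(m))=\binom{\frac{n}{n+p}}{i_1+\dots+i_{n-1}}\frac{(i_1+\dots+i_{n-1})!}{i_1!\,i_2!\cdots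 i_{n-1}!}.$$ For real $p\ne -n$ and integers $k,m\ge 0$, $$\mathcal{W}^p_{m,k}(K)=\int_{\partial K}\langle x,N(x)\rangle^{m-k+\frac{n(1-p)}{n+p}}H_{n-1}^{\frac{p}{n+p}}\sum_{\substack{i_1,\dots,i_{n-1}\ge 0\\ i_1+2i_2+\dots+(n-1)i_{n-1}=m}}c(n,p,i(m))\prod_{j=1}^{n-1}\binom{n-1}{j}^{i_j}H_j^{i_j}\,d\mathcal{H}^{n-1},$$ and the $L_p$-Steiner quermassintegrals are $$\mathcal{V}^p_k(K)=\sum_{m=0}^{k}\binom{\frac{n(1-p)}{n+p}}{k-m}\mathcal{W}^p_{m,k}(K).$$ *)

(* Defs.v *)
(* Points of R^n are row vectors, with the product topology; the library norm on
   matrices is the sup norm, so every metric notion below is phrased through the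
   Euclidean inner product instead. *)
From HB Require Import structures.
From mathcomp Require Import all_boot all_order all_algebra.
From mathcomp Require Import all_classical all_reals all_analysis.

Set Implicit Arguments.
Unset Strict Implicit.
Unset Printing Implicit Defensive.

Import Order.TTheory GRing.Theory Num.Theory.
Import numFieldNormedType.Exports.

Local Open Scope classical_set_scope.
Local Open Scope ring_scope.

Section euclidean.
Context {R : realType} {n : nat}.
Implicit Types (x y u v : 'rV[R]_n) (K : set 'rV[R]_n).

Definition dotv u v : R := \sum_i u 0 i * v 0 i.

Definition enorm u : R := Num.sqrt (dotv u u).

Definition eball y (r : R) : set 'rV[R]_n := [set z | enorm (z - y) <= r].

Definition bdry K : set 'rV[R]_n := closure K `\` K°.

End euclidean.

Section hausdorff.
Context {R : realType} {n : nat}.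
Implicit Types (U A : set 'rV[R]_n).
Local Open Scope ereal_scope.

(* The 0 only matters for U = set0, whose supremum would be -oo. *)
Definition ediam U : \bar R :=
  ereal_sup (0 |` [set (enorm (x - y))%:E | x in U & y in U]).

(* Volume of the unit ball of R^d: omega_d = (2 pi / d) omega_(d-2). *)
Fixpoint ball_volume (d : nat) : R :=
  (if d is d'.+1 then
     if d' is d''.+1 then 2 * pi / d%:R * ball_volume d'' else 2
   else 1)%R.

(* omega_d (diam U / 2)^d, with value 0 at set0 also for d = 0. *)
Definition hausdorff_weight (d : nat) U : \bar R :=
  if U == set0 then 0 else (ball_volume d / 2 ^+ d)%:E * ediam U ^+ d.

Definition fine_cover (delta : R) A : set ((set 'rV[R]_n)^nat) :=
  [set U : (set 'rV[R]_n)^nat |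
    (forall i, ediam (U i) <= delta%:E) /\ A `<=` \bigcup_i U i].

Definition hausdorff_pre (d : nat) (delta : R) A : \bar R :=
  ereal_inf [set \sum_(i <oo) hausdorff_weight d (U i) | U in fine_cover delta A].

(* The d-dimensional Hausdorff outer measure on R^n. *)
Definition hausdorff (d : nat) A : \bar R :=
  ereal_sup [set hausdorff_pre d delta A | delta in [set delta : R | (0 < delta)%R]].

Lemma ball_volume_ge0 d : (0 <= ball_volume d)%R.
Proof.
suff: (0 <= ball_volume d)%R && (0 <= ball_volume d.+1)%R by case/andP.
elim: d => [|d /andP[h0 h1]]; first by rewrite /= ler01 ler0n.
by rewrite h1 /= mulr_ge0// divr_ge0// mulr_ge0// pi_ge0.
Qed.

Lemma ediam_ge0 U : 0 <= ediam U.
Proof. by apply: ereal_sup_ubound; left. Qed.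

Lemma ediam0 : ediam set0 = 0.
Proof.
rewrite /ediam (_ : [set _ | x in _ & y in _] = set0) ?setU0 ?ereal_sup1//.
by rewrite -subset0 => z [].
Qed.

Lemma hausdorff_weight_ge0 d U : 0 <= hausdorff_weight d U.
Proof.
rewrite /hausdorff_weight; case: ifP => // _; apply: mule_ge0.
  by rewrite lee_fin divr_ge0 ?ball_volume_ge0// exprn_ge0.
by apply: expe_ge0; exact: ediam_ge0.
Qed.

Lemma hausdorff_weight0 d : hausdorff_weight d set0 = 0.
Proof. by rewrite /hausdorff_weight eqxx. Qed.

Lemma hausdorff_pre_ge0 d delta A : 0 <= hausdorff_pre d delta A.
Proof.
apply: le_ereal_inf_tmp => _ [U _ <-].
by apply: nneseries_ge0 => i _ _; exact: hausdorff_weight_ge0.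
Qed.

Lemma hausdorff_ge0 d A : 0 <= hausdorff d A.
Proof.
apply: le_trans (hausdorff_pre_ge0 d 1 A) _.
by apply: ereal_sup_ubound; exists 1%R => //=.
Qed.

Lemma hausdorff0 d : hausdorff d set0 = 0.
Proof.
apply/eqP; rewrite eq_le hausdorff_ge0 andbT.
apply: ge_ereal_sup => _ [delta /= delta0 <-].
apply: ereal_inf_lbound; exists (fun=> set0).
  by split => // i; rewrite ediam0 lee_fin ltW.
by rewrite eseries0// => i _ _; exact: hausdorff_weight0.
Qed.

Lemma hausdorff_pre_subadditive d delta A (F : (set 'rV[R]_n)^nat) :
  subset_sigma_subadditive (hausdorff_pre d delta) A F.
Proof.
move=> AF; set mu := hausdorff_weight d.
have mu_ge0 X : 0 <= mu X by exact: hausdorff_weight_ge0.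
have [[i ioo]|] := pselect (exists i, hausdorff_pre d delta (F i) = +oo).
  rewrite (eseries_pinfty _ _ ioo) ?leey// => k _.
  by rewrite -ltNye (lt_le_trans _ (hausdorff_pre_ge0 _ _ _)).
rewrite -forallNE => Foo.
suff add2e (e : {posnum R}) : hausdorff_pre d delta A <=
    \sum_(i <oo) hausdorff_pre d delta (F i) + e%:num%:E.
  by apply/lee_addgt0Pr => _/posnumP[].
rewrite (le_trans _ (epsilon_trick _ _ _))//; last first.
  by move=> k; exact: hausdorff_pre_ge0.
pose P k (B : (set 'rV[R]_n)^nat) := fine_cover delta (F k) B /\
  \sum_(j <oo) mu (B j) <=
    hausdorff_pre d delta (F k) + (e%:num / (2 ^ k.+1)%:R)%:E.
have [G PG] : {G : ((set 'rV[R]_n)^nat)^nat & forall k, P k (G k)}.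
  apply: (@choice _ _ P) => k; rewrite /P /hausdorff_pre.
  set S := (X in ereal_inf X); move infS : (ereal_inf S) => iS.
  case: iS infS => [r Sr|Soo|Soo].
  - have en1 : (0 < e%:num / (2 ^ k.+1)%:R)%R by [].
    have /(lb_ereal_inf_adherent en1) : ereal_inf S \is a fin_num by rewrite Sr.
    move=> [x [B BF muBx] xS].
    by exists B; split => //; rewrite muBx -Sr; exact/ltW.
  - by have := Foo k; rewrite /hausdorff_pre Soo.
  - suff : lbound S 0 by move/le_ereal_inf_tmp; rewrite Soo.
    by move=> /= _ [B _ <-]; exact: nneseries_ge0.
have muG_ge0 x : 0 <= (mu \o uncurry G) x by exact: mu_ge0.
apply: (@le_trans _ _ (\esum_(i in setT) (mu \o uncurry G) i)).
  apply: ereal_inf_lbound => /=.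
  have /card_esym/ppcard_eqP[f] := card_nat2.
  exists (uncurry G \o f).
    split => [i|]; first by rewrite /= /uncurry; case: (f i) => a b; exact: (PG a).1.1.
    apply: (subset_trans AF) => t [i _] /(PG i).1.2 [j _ Gijt].
    by exists (f^-1%FUN (i, j)) => //=; rewrite invK ?inE.
  rewrite -(esum_pred_image (mu \o uncurry G) _ xpredT) ?[fun=> _]set_true//.
  by rewrite image_eq.
rewrite (_ : esum _ _ = \sum_(i <oo) \sum_(j <oo ) mu (G i j)); last first.
  pose J : nat -> set (nat * nat) := fun i => [set (i, j) | j in setT].
  rewrite (_ : setT = \bigcup_k J k); last first.
    by rewrite predeqE => -[a b]; split => // _; exists a => //; exists b.
  rewrite esum_bigcupT /=; last 2 first.
    - apply/trivIsetP => i j _ _ ij.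
      rewrite predeqE => -[a b] /=; split => //= -[] [_] _ [<-{a} _].
      by move=> [b' _] [] /esym/eqP; rewrite (negbTE ij).
    - by move=> /= [a b]; exact: mu_ge0.
  rewrite -(image_id [set: nat]) -fun_true esum_pred_image//; last first.
    by move=> k _; exact: esum_ge0.
  apply: eq_eseriesr => /= j _.
  rewrite -(esum_pred_image (mu \o uncurry G) (pair j) predT)//=; last first.
    by move=> ? ? _ _; exact: (@can_inj _ _ _ snd).
  by congr esum; rewrite predeqE => -[a b]; split; move=> [i _ <-]; exists i.
apply: lee_nneseries => [k _ _|k _]; last exact: (PG k).2.
by apply: nneseries_ge0 => j *; exact: mu_ge0.
Qed.

Lemma hausdorff_subadditive d A (F : (set 'rV[R]_n)^nat) :
  subset_sigma_subadditive (hausdorff d) A F.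
Proof.
move=> AF; apply: ge_ereal_sup => _ [delta delta0 <-].
apply: le_trans (hausdorff_pre_subadditive d delta AF) _.
apply: lee_nneseries => [k _ _|k _]; first exact: hausdorff_pre_ge0.
by apply: ereal_sup_ubound; exists delta.
Qed.

HB.instance Definition _ (d : nat) := isSubsetOuterMeasure.Build R 'rV[R]_n
  (hausdorff d) (hausdorff0 d) (hausdorff_ge0 d) (@hausdorff_subadditive d).

(* Hausdorff measure on the (complete) sigma-algebra of Caratheodory measurable
   sets, which contains the Borel sets. *)
Definition hausdorff_measure (d : nat) :
    set (caratheodory_type (hausdorff d)) -> \bar R :=
  hausdorff d.
Arguments hausdorff_measure : clear implicits.
HB.instance Definition _ (d : nat) := isMeasure.Build _ _ _
  (hausdorff_measure d) (@caratheodory_measure0 _ _ (hausdorff d))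
  (@caratheodory_measure_ge0 _ _ (hausdorff d))
  (@caratheodory_measure_sigma_additive _ _ (hausdorff d)).

End hausdorff.

Arguments hausdorff_measure : clear implicits.

Section convex_bodies.
Context {R : realType} {n : nat}.
Implicit Types (x u v : 'rV[R]_n) (K : set 'rV[R]_n).

(* Nonempty interior is implied by the last condition. *)
Definition convex_body_o K : Prop :=
  [/\ compact K, convex_set (K : set (convex_lmodType 'rV[R]_n)) & K° 0].

Definition outer_unit_normal K x u : Prop :=
  dotv u u = 1 /\ forall y, K y -> dotv (y - x) u <= 0.

(* N(x); a choice among the outer unit normals where these are not unique. *)
Definition normal K x : 'rV[R]_n := xget 0 (outer_unit_normal K x).

Definition inner_rolling_ball K : Prop :=
  exists2 r : R, 0 < r & forall x, bdry K x ->
    exists2 u, outer_unit_normal K x u & eball (x - r *: u) r `<=` K.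

Definition outer_rolling_ball K : Prop :=
  exists2 r : R, 0 < r & forall x, bdry K x ->
    exists2 u, outer_unit_normal K x u & K `<=` eball (x - r *: u) r.

Definition class_C K : Prop :=
  [/\ convex_body_o K, inner_rolling_ball K & outer_rolling_ball K].

(* t = f(v), where f is the convex function on the tangent space N(x)^perp (near
   0) whose graph v |-> x + v - f(v) N(x) is the boundary of K near x. *)
Definition tangent_graph K x v (t : R) : Prop :=
  K (x + v - t *: normal K x) /\
  forall s : R, K (x + v - s *: normal K x) -> t <= s.

(* The generalized principal curvatures k of K at x, in some order: f is twice
   differentiable at 0 in the sense of Alexandrov,
     f(v) = 1/2 sum_i k_i <v, e_i>^2 + o(|v|^2),
   where the principal directions e_i (the rows of E) are an orthonormal basis
   of N(x)^perp; i.e. the k_i are the eigenvalues of the Hessian of f at 0. *)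
Definition is_principal_curvatures K x (k : 'rV[R]_n.-1) : Prop :=
  exists E : 'M[R]_(n.-1, n),
    [/\ E *m E^T = 1%:M,
        forall i, dotv (row i E) (normal K x) = 0 &
        forall e : R, 0 < e -> \forall v \near (0 : 'rV[R]_n),
          dotv v (normal K x) = 0 ->
          exists2 t, tangent_graph K x v t &
            `| t - 2^-1 * \sum_i k 0 i * dotv v (row i E) ^+ 2 |
              <= e * enorm v ^+ 2].

Definition principal_curvatures K x : 'rV[R]_n.-1 :=
  xget 0 (is_principal_curvatures K x).

(* H_j; the sum is 1 for j = 0. *)
Definition mean_curvature K (j : nat) x : R :=
  ('C(n.-1, j)%:R)^-1 *
  \sum_(J : {set 'I_n.-1} | #|J| == j) \prod_(i in J) principal_curvatures K x 0 i.

End convex_bodies.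

Section quermassintegrals.
Context {R : realType}.

(* The lower index is always nonnegative below. *)
Definition gbinom (alpha : R) (k : nat) : R :=
  (\prod_(i < k) (alpha - i%:R)) / k`!%:R.

(* In the next two definitions the index j : 'I_n.-1 stands for j + 1, so that
   i j is the multi-index entry i_(j+1). *)
Definition steiner_coef (n : nat) (p : R) (i : 'I_n.-1 -> nat) : R :=
  gbinom (n%:R / (n%:R + p)) (\sum_j i j)%N *
  ((\sum_j i j)%N`!%:R / \prod_j (i j)`!%:R).

(* The entries of a multi-index of weight m are at most m, so that summing over
   functions into 'I_m.+1 loses nothing. *)
Definition steinerW (n : nat) (p : R) (m k : nat) (K : set 'rV[R]_n) : R :=
  \int[hausdorff_measure R n n.-1]_(x in bdry K)
    (dotv x (normal K x) `^ (m%:R - k%:R + n%:R * (1 - p) / (n%:R + p)) *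
     mean_curvature K n.-1 x `^ (p / (n%:R + p)) *
     \sum_(i : {ffun 'I_n.-1 -> 'I_m.+1} | (\sum_(j < n.-1) j.+1 * i j)%N == m)
       (steiner_coef (n := n) p (fun j => i j) *
        \prod_(j < n.-1)
          ('C(n.-1, j.+1)%:R ^+ i j * mean_curvature K j.+1 x ^+ i j))).

Definition steinerV (n : nat) (p : R) (k : nat) (K : set 'rV[R]_n) : R :=
  \sum_(m < k.+1)
    gbinom (n%:R * (1 - p) / (n%:R + p)) (k - m)%N * steinerW p m k K.

End quermassintegrals.

(* Main.v *)
Require Import Defs.
From HB Require Import structures.
From mathcomp Require Import all_boot all_order all_algebra.
From mathcomp Require Import perm ring lra.
From mathcomp Require Import all_classical all_reals all_analysis.

(** Dilations, rotations and reflections are all maps x |-> a (x T) with a > 0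
    and T orthogonal, and both parts of the theorem are instances of one
    scaling rule for such similarities f:

      W^p_{m,k}(f K) = a^(n (n-p)/(n+p) - k) W^p_{m,k}(K),

    part (i) being T = 1 and part (ii) being a = 1.  As the exponent does not
    involve m, the rule passes to V^p_k term by term.

    The rule comes from the change of variables y = f x on the boundary.
    Hausdorff measure of dimension n-1 is multiplied by a^(n-1)
    ([hausdorff_dilates]), and the integrand is homogeneous
    ([steiner_integrand_similarity]): the support function <x, N(x)> has degree
    1 and H_j has degree -j, so that the terms with i_1 + 2 i_2 + ... = m
    have degree -m, and
      n-1 + m-k + n(1-p)/(n+p) - (n-1)p/(n+p) - m  =  n(n-p)/(n+p) - k.

    Three points need care, because normals, curvatures and integrals are total
    functions that involve choices.
    - The inner rolling ball makes the outer unit normal unique at every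
      boundary point ([outer_unit_normal_unique]), so the chosen normal is
      carried along by f ([normal_similarity]).
    - Principal curvatures are chosen up to their order.  The second order
      expansion determines the quadratic form sum_i k_i <v, e_i>^2 on the tangent
      space ([hessian_form_unique]); two orthonormal frames of that space differ
      by an orthogonal matrix, so two choices of curvatures are spectra of
      orthogonally similar matrices, and their elementary symmetric functions
      agree ([elem_sym_principal_curvatures]).  Where no curvatures exist, all
      H_j with j > 0 are 0 for both K and f K.  Convexity gives
      H_(n-1) >= 0 ([mean_curvature_ge0]), which the real powers require.
    - The chosen curvatures give no hold on the measurability of the integrand.
      The change of variables holds for arbitrary functions, since a bijection
      that scales the measure matches the simple functions below the two
      integrands ([Rintegral_bijection]). *)

Set Implicit Arguments.
Unset Strict Implicit.
Unset Printing Implicit Defensive.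

Import Order.TTheory GRing.Theory Num.Theory.
Import numFieldNormedType.Exports.

Local Open Scope classical_set_scope.
Local Open Scope ring_scope.

(** * Hausdorff measure under dilating maps *)

Section hausdorff_similarity.
Context {R : realType} {n : nat}.
Implicit Types (A U : set 'rV[R]_n) (f g : 'rV[R]_n -> 'rV[R]_n).
Local Open Scope ereal_scope.

Definition dilates (L : R) f := forall x y, enorm (f x - f y) = (L * enorm (x - y))%R.

Lemma ediam_dilates L f U : (0 < L)%R -> dilates L f ->
  ediam (f @` U) <= L%:E * ediam U.
Proof.
move=> L0 fL; apply: ge_ereal_sup => z [->|].
  by apply: mule_ge0; [rewrite lee_fin ltW|exact: ediam_ge0].
case=> _ [x Ux <-] [_ [y Uy <-] <-].
rewrite fL EFinM lee_pmul2l//.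
by apply: ereal_sup_ubound; right; exists x => //; exists y.
Qed.

Lemma hausdorff_weight_dilates L f d U : (0 < L)%R -> dilates L f ->
  hausdorff_weight d (f @` U) <= (L ^+ d)%:E * hausdorff_weight d U.
Proof.
move=> L0 fL; rewrite /hausdorff_weight.
have [->|U0] := eqVneq U set0; first by rewrite image_set0 eqxx mule0.
rewrite ifF; last by apply: contraNF U0 => /eqP/image_set0_set0 ->.
rewrite muleCA lee_wpmul2l//.
  by rewrite lee_fin divr_ge0 ?ball_volume_ge0// exprn_ge0.
have dL := ediam_dilates U L0 fL.
elim: d => [|d IH]; first by rewrite !expe0 mul1e.
rewrite !expeS exprS EFinM muleACA lee_pmul ?ediam_ge0 ?expe_ge0//.
exact: ediam_ge0.
Qed.

(** The image under f of a cover of A is a cover of f A, with diameters and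
    mesh multiplied by L. *)
Lemma hausdorff_pre_dilates L f d delta A : (0 < L)%R -> dilates L f ->
  hausdorff_pre d (L * delta) (f @` A) <= (L ^+ d)%:E * hausdorff_pre d delta A.
Proof.
move=> L0 fL; have Ld0 : (0 < L ^+ d)%R by rewrite exprn_gt0.
rewrite -lee_pdivrMl//; apply: le_ereal_inf_tmp => _ [U [Ud AU] <-].
rewrite lee_pdivrMl// -nneseriesZl; last first.
  by move=> i _; exact: hausdorff_weight_ge0.
apply: (@le_trans _ _ (\sum_(i <oo) hausdorff_weight d (f @` U i))).
  apply: ereal_inf_lbound; exists (fun i => f @` U i) => //; split=> [i|].
    apply: le_trans (ediam_dilates _ L0 fL) _.
    by rewrite EFinM lee_pmul2l// lte_fin.
  by rewrite -image_bigcup; exact: image_subset.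
apply: lee_nneseries => [i _ _|i _]; first exact: hausdorff_weight_ge0.
exact: hausdorff_weight_dilates.
Qed.

Lemma hausdorff_dilates_le L f d A : (0 < L)%R -> dilates L f ->
  hausdorff d (f @` A) <= (L ^+ d)%:E * hausdorff d A.
Proof.
move=> L0 fL; apply: ge_ereal_sup => _ [delta /= delta0 <-].
rewrite -[delta](mulVKf (lt0r_neq0 L0)).
apply: le_trans (hausdorff_pre_dilates _ _ _ L0 fL) _.
rewrite lee_pmul2l ?lte_fin ?exprn_gt0//.
by apply: ereal_sup_ubound; exists (L^-1 * delta)%R => //=; rewrite mulr_gt0 ?invr_gt0.
Qed.

Lemma dilates_inv L f g : (0 < L)%R -> cancel g f -> dilates L f -> dilates L^-1 g.
Proof.
by move=> L0 gK fL x y; rewrite -[in RHS](gK x) -[in RHS](gK y) fL mulKf// gt_eqF.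
Qed.

(** The inequality for f and the one for its inverse, which dilates by 1/L. *)
Lemma hausdorff_dilates L f g d A : (0 < L)%R -> cancel f g -> cancel g f ->
  dilates L f -> hausdorff d (g @^-1` A) = (L ^+ d)%:E * hausdorff d A.
Proof.
move=> L0 fK gK fL; apply/eqP; rewrite eq_le; apply/andP; split.
  apply: le_trans (hausdorff_dilates_le d A L0 fL).
  apply: (le_outer_measure (hausdorff d)) => x /= Agx; exists (g x) => //.
rewrite -lee_pdivlMl ?exprn_gt0// -exprVn.
have L'0 : (0 < L^-1)%R by rewrite invr_gt0.
apply: le_trans (hausdorff_dilates_le d _ L'0 (dilates_inv L0 gK fL)).
apply: (le_outer_measure (hausdorff d)) => x Ax /=; exists (f x) => //=.
by rewrite fK.
Qed.

(** A bijection that scales the outer measure preserves the additive splitting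
    that defines measurable sets. *)
Lemma caratheodory_dilates L f g d A : (0 < L)%R -> cancel f g -> cancel g f ->
  dilates L f -> (hausdorff d).-caratheodory A ->
  (hausdorff d).-caratheodory (g @^-1` A).
Proof.
move=> L0 fK gK fL mA X.
have XE : X = g @^-1` (f @^-1` X) by apply/funext => x /=; rewrite gK.
rewrite XE preimage_setC -!preimage_setI !(hausdorff_dilates _ _ L0 fK gK fL).
by rewrite mA ge0_muleDr// outer_measure_ge0.
Qed.

End hausdorff_similarity.

(** * Change of variables for integrals of arbitrary functions *)

Section integral_bijection.
Context d (T : measurableType d) (R : realType).
Variable mu : {measure set T -> \bar R}.
Local Open Scope ereal_scope.
Import HBSimple HBNNSimple.

(* A simple function h below F yields the simple function b^-1 (h o f) below G,
   whose integral is that of h divided by c b. *)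
Let ge0_integral_bijection_le (f g : T -> T) (c b : R) (F G : T -> \bar R) :
  cancel f g -> cancel g f -> measurable_fun setT f -> measurable_fun setT g ->
  (0 < c)%R -> (0 < b)%R ->
  (forall A, measurable A -> mu (g @^-1` A) = c%:E * mu A) ->
  (forall x, 0 <= F x) -> (forall x, 0 <= G x) ->
  (forall x, F (f x) = b%:E * G x) ->
  \int[mu]_x F x <= (c * b)%:E * \int[mu]_x G x.
Proof.
move=> fK gK mf mg c0 b0 mug F0 G0 FG.
rewrite !ge0_integralTE//; apply: ge_ereal_sup => _ [h /= hF <-].
have mh : measurable_fun setT (h \o f).
  by apply: measurableT_comp => //; exact: measurable_funPT.
have fh : finite_set (range (h \o f)).
  apply: sub_finite_set (fimfunP h) => _ [x _ <-]; by exists (f x).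
have h0 x : (0 <= (h \o f) x)%R by exact: fun_ge0.
pose hf : {nnsfun T >-> R} := HB.pack (h \o f) (isMeasurableFun.Build _ _ _ _ _ mh)
  (FiniteImage.Build _ _ _ fh) (isNonNegFun.Build _ _ _ h0).
have b'0 : (0 <= b^-1)%R by rewrite invr_ge0 ltW.
have -> : sintegral mu h = (c * b)%:E * sintegral mu (scale_nnsfun hf b'0).
  rewrite (sintegralrM mu b^-1%R hf) muleA -EFinM mulfK ?gt_eqF//.
  rewrite !sintegralET ge0_mule_fsumr; last by move=> x; exact: nnsfun_mulemu_ge0.
  apply: eq_fsbigr => x _; rewrite muleCA -mug//; congr (_ * mu _).
  by apply/funext => y /=; rewrite gK.
rewrite lee_pmul2l ?lte_fin ?mulr_gt0//.
apply: ereal_sup_ubound; exists (scale_nnsfun hf b'0) => //= x.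
by rewrite EFinM lee_pdivrMl// -FG.
Qed.

Lemma ge0_integral_bijection (f g : T -> T) (c b : R) (F G : T -> \bar R) :
  cancel f g -> cancel g f -> measurable_fun setT f -> measurable_fun setT g ->
  (0 < c)%R -> (0 < b)%R ->
  (forall A, measurable A -> mu (g @^-1` A) = c%:E * mu A) ->
  (forall x, 0 <= F x) -> (forall x, 0 <= G x) ->
  (forall x, F (f x) = b%:E * G x) ->
  \int[mu]_x F x = (c * b)%:E * \int[mu]_x G x.
Proof.
move=> fK gK mf mg c0 b0 mug F0 G0 FG; apply/eqP; rewrite eq_le; apply/andP; split.
  exact: (@ge0_integral_bijection_le f g).
rewrite -lee_pdivlMl ?mulr_gt0// invfM.
apply: (@ge0_integral_bijection_le g f); rewrite ?invr_gt0//.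
  move=> A mA; rewrite -[A in RHS](_ : g @^-1` (f @^-1` A) = _); last first.
    by apply/funext => x /=; rewrite gK.
  rewrite mug; last by rewrite -[X in measurable X]setTI; exact: mf.
  by rewrite muleA -EFinM mulVf ?gt_eqF// mul1e.
by move=> x; rewrite -[in RHS](gK x) FG muleA -EFinM mulVf ?gt_eqF// mul1e.
Qed.

(** The integral is a difference of two suprema over simple functions, and
    h |-> b^-1 (h o f) matches the two families one to one; measurability of the
    integrands does not enter. *)
Lemma Rintegral_bijection (f g : T -> T) (c b : R) (D' D : set T) (F G : T -> R) :
  cancel f g -> cancel g f -> measurable_fun setT f -> measurable_fun setT g ->
  (0 < c)%R -> (0 < b)%R ->
  (forall A, measurable A -> mu (g @^-1` A) = c%:E * mu A) ->
  (forall x, D' (f x) <-> D x) ->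
  (forall x, D x -> F (f x) = b * G x)%R ->
  (\int[mu]_(x in D') F x = c * b * \int[mu]_(x in D) G x)%R.
Proof.
move=> fK gK mf mg c0 b0 mug DD FG; rewrite /Rintegral.
have -> : \int[mu]_(x in D') (F x)%:E = (c * b)%:E * \int[mu]_(x in D) (G x)%:E.
  rewrite integral_mkcond [in RHS]integral_mkcond.
  set F' := _ \_ _; set G' := _ \_ _.
  have FG' x : F' (f x) = b%:E * G' x.
    rewrite /F' /G' !patchE.
    have -> : (f x \in D') = (x \in D) by apply/idP/idP; rewrite !inE => /DD.
    by case: ifPn; rewrite ?mule0// inE => Dx; rewrite FG.
  have cb0 : (0 < c * b)%R by rewrite mulr_gt0.
  have FGp x : F'^\+ (f x) = b%:E * G'^\+ x.
    by rewrite !funeposE FG' maxe_pMr ?mule0// lee_fin ltW.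
  have FGn x : F'^\- (f x) = b%:E * G'^\- x.
    by rewrite !funenegE FG' maxe_pMr ?mule0 ?muleN// lee_fin ltW.
  rewrite integralE [in RHS]integralE.
  rewrite (ge0_integral_bijection fK gK mf mg c0 b0 mug _ _ FGp)//.
  rewrite (ge0_integral_bijection fK gK mf mg c0 b0 mug _ _ FGn)//.
  (* c b > 0 is finite, so it distributes even over oo - oo. *)
  move: (\int[mu]_x G'^\+ x) (\int[mu]_x G'^\- x) => [x| |] [y| |];
    rewrite /= ?(gt0_muley, gt0_muleNy) ?lte_fin//=.
  by apply: (congr1 EFin); rewrite mulrBr.
case: (\int[mu]_(x in D) (G x)%:E) => [x| |] //=;
  by rewrite ?(gt0_muley, gt0_muleNy) ?lte_fin ?mulr_gt0//= mulr0.
Qed.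

End integral_bijection.

(** * The Euclidean inner product *)

Section euclidean_facts.
Context {R : realType} {n : nat}.
Implicit Types (x y u v w : 'rV[R]_n) (T : 'M[R]_n).

Lemma dotvE u v : dotv u v = (u *m v^T) 0 0.
Proof. by rewrite /dotv mxE; apply: eq_bigr => i _; rewrite mxE. Qed.

Lemma dotvC u v : dotv u v = dotv v u.
Proof. by apply: eq_bigr => i _; rewrite mulrC. Qed.

Lemma dotvDl u v w : dotv (u + v) w = dotv u w + dotv v w.
Proof. by rewrite !dotvE mulmxDl mxE. Qed.

Lemma dotvZl (s : R) u v : dotv (s *: u) v = s * dotv u v.
Proof. by rewrite !dotvE -scalemxAl mxE. Qed.

Lemma dotvNl u v : dotv (- u) v = - dotv u v.
Proof. by rewrite -scaleN1r dotvZl mulN1r. Qed.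

Lemma dotvBl u v w : dotv (u - v) w = dotv u w - dotv v w.
Proof. by rewrite dotvDl dotvNl. Qed.

Lemma dotvBr u v w : dotv w (u - v) = dotv w u - dotv w v.
Proof. by rewrite !(dotvC w) dotvBl. Qed.

Lemma dotvZr (s : R) u v : dotv u (s *: v) = s * dotv u v.
Proof. by rewrite !(dotvC u) dotvZl. Qed.

Lemma dotv_ge0 u : 0 <= dotv u u.
Proof. by apply: sumr_ge0 => i _; rewrite -expr2 sqr_ge0. Qed.

Lemma dotv_eq0 u : dotv u u = 0 -> u = 0.
Proof.
move/eqP; rewrite psumr_eq0 => [/allP u0|i _]; last by rewrite -expr2 sqr_ge0.
apply/rowP => i; rewrite mxE; apply/eqP.
by have := u0 i (mem_index_enum i); rewrite /= mulf_eq0 orbb.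
Qed.

Lemma enorm_sqr u : enorm u ^+ 2 = dotv u u.
Proof. by rewrite sqr_sqrtr// dotv_ge0. Qed.

Lemma enormZ (s : R) u : 0 <= s -> enorm (s *: u) = s * enorm u.
Proof.
move=> s0; rewrite /enorm dotvZl dotvZr mulrA -expr2 sqrtrM ?sqr_ge0//.
by rewrite sqrtr_sqr ger0_norm.
Qed.

Lemma dotv_ortho T u v : T *m T^T = 1%:M -> dotv (u *m T) (v *m T) = dotv u v.
Proof.
by move=> TT; rewrite !dotvE trmx_mul mulmxA -(mulmxA u) TT mulmx1.
Qed.

Lemma dotv_adjoint m (E : 'M[R]_(m, n)) (v : 'rV_n) i :
  dotv v (row i E) = (v *m E^T) 0 i.
Proof. by rewrite /dotv mxE; apply: eq_bigr => j _; rewrite !mxE. Qed.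

End euclidean_facts.

(** * Elementary symmetric functions of the coefficients of a diagonal form *)

Section elementary_symmetric.
Context {R : realType} {m : nat}.
Implicit Types k : 'rV[R]_m.

Definition elem_sym j k : R :=
  \sum_(J : {set 'I_m} | #|J| == j) \prod_(i in J) k 0 i.

Lemma elem_symZ j (c : R) k : elem_sym j (c *: k) = c ^+ j * elem_sym j k.
Proof.
rewrite /elem_sym big_distrr; apply: eq_bigr => J /eqP <- /=.
under eq_bigr do rewrite mxE.
by rewrite big_split/= prodr_const.
Qed.

Lemma elem_sym0 j : (0 < j)%N -> elem_sym j 0 = 0.
Proof.
by move=> j0; rewrite -(scale0r 0) elem_symZ expr0n eqn0Ngt j0 mul0r.
Qed.

Lemma elem_sym_ge0 j k : (forall i, 0 <= k 0 i) -> 0 <= elem_sym j k.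
Proof. by move=> k0; apply: sumr_ge0 => J _; apply: prodr_ge0. Qed.

End elementary_symmetric.

Section diagonal_forms.
Context {R : realType}.

Definition qform {m} (k w : 'rV[R]_m) : R := \sum_i k 0 i * w 0 i ^+ 2.

Lemma qformE m (k w : 'rV[R]_m) : qform k w = (w *m diag_mx k *m w^T) 0 0.
Proof.
rewrite mxE; apply: eq_bigr => i _; rewrite mul_mx_diag !mxE.
by rewrite mulrAC -expr2 mulrC.
Qed.

Lemma symmetric_form_eq0 m (A : 'M[R]_m) : A^T = A ->
  (forall w : 'rV_m, (w *m A *m w^T) 0 0 = 0) -> A = 0.
Proof.
move=> AT A0.
have Aij i j : ((delta_mx 0 i : 'rV[R]_m) *m A *m (delta_mx 0 j : 'rV[R]_m)^T) 0 0 = A i j.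
  by rewrite trmx_delta -rowE -colE !mxE.
apply/matrixP => i j; rewrite mxE.
have := A0 (delta_mx 0 i + delta_mx 0 j).
rewrite linearD /= !(mulmxDl, mulmxDr) mxE [X in X + _]mxE [X in _ + X]mxE.
rewrite !Aij -[A i i]Aij -[A j j]Aij !A0 add0r addr0 -[in A j i]AT mxE.
by move/eqP; rewrite -mulr2n mulrn_eq0 => /eqP.
Qed.

(** The determinants of Q and Q^T cancel in det (X - Q A Q^T). *)
Lemma char_poly_ortho m (Q A : 'M[R]_m) : Q *m Q^T = 1%:M ->
  char_poly (Q *m A *m Q^T) = char_poly A.
Proof.
move=> QQ; rewrite /char_poly.
have -> : char_poly_mx (Q *m A *m Q^T) =
    map_mx polyC Q *m char_poly_mx A *m map_mx polyC Q^T.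
  rewrite /char_poly_mx mulmxBr mulmxBl !map_mxM; congr (_ - _).
  by rewrite mul_mx_scalar -scalemxAl -map_mxM QQ map_mx1 scalemx1.
rewrite !det_mulmx mulrAC -det_mulmx -map_mxM QQ map_mx1 det1 mul1r.
by [].
Qed.

(** The forms have matrices diag k = Q (diag k') Q^T, hence the same
    characteristic polynomial; its roots are the k_i on one side and the k'_i on
    the other, so k is a rearrangement of k'. *)
Lemma elem_sym_qform m (Q : 'M[R]_m) (k k' : 'rV[R]_m) j : Q *m Q^T = 1%:M ->
  (forall w, qform k w = qform k' (w *m Q)) -> elem_sym j k = elem_sym j k'.
Proof.
move=> QQ kk'.
have DE : diag_mx k = Q *m diag_mx k' *m Q^T.
  apply/eqP; rewrite -subr_eq0; apply/eqP; apply: symmetric_form_eq0.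
    by rewrite linearB /= !trmx_mul trmxK !tr_diag_mx mulmxA.
  move=> w; rewrite mulmxBr mulmxBl mxE [X in _ + X]mxE -qformE kk' qformE.
  by rewrite trmx_mul !mulmxA subrr.
have cE (c : 'rV[R]_m) : char_poly (diag_mx c) =
    \prod_(x <- [tuple c 0 i | i < m]) ('X - x%:P).
  rewrite char_poly_trig ?diag_mx_is_trig// big_map ?val_ord_tuple big_enum /=.
  by apply: eq_bigr => i _; rewrite mxE eqxx.
have /tuple_permP[s sE] : perm_eq [tuple k 0 i | i < m] [tuple k' 0 i | i < m].
  by apply: prod_XsubC_eq; rewrite -!cE DE char_poly_ortho.
have ks i : k 0 i = k' 0 (s i).
  have := congr1 (fun t => nth 0 t i) sE.
  by rewrite -!tnth_nth !tnth_mktuple.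
rewrite /elem_sym [RHS](reindex_inj (imset_inj (@perm_inj _ s))) /=.
apply: eq_big => [J|J _]; first by rewrite card_imset//; exact: perm_inj.
rewrite big_imset /=; last by move=> x y _ _; exact: perm_inj.
exact: eq_bigr.
Qed.

End diagonal_forms.

(** * Similarities, boundaries and normals *)

Section similarity.
Context {R : realType} {n : nat}.
Implicit Types (x y u v w : 'rV[R]_n) (T : 'M[R]_n) (K : set 'rV[R]_n) (a : R).

Definition similarity a T x := a *: (x *m T).

Definition orthogonal_mx T := T *m T^T = 1%:M.

Lemma orthogonal_trmx T : orthogonal_mx T -> orthogonal_mx T^T.
Proof. by rewrite /orthogonal_mx trmxK; exact: mulmx1C. Qed.

Lemma similarityK a T : 0 < a -> orthogonal_mx T ->
  cancel (similarity a T) (similarity a^-1 T^T).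
Proof.
move=> a0 TT x; rewrite /similarity -scalemxAl scalerA mulVf ?gt_eqF// scale1r.
by rewrite -mulmxA TT mulmx1.
Qed.

Lemma similarityVK a T : 0 < a -> orthogonal_mx T ->
  cancel (similarity a^-1 T^T) (similarity a T).
Proof.
move=> a0 TT; have := @similarityK a^-1 T^T; rewrite invrK trmxK; apply.
  by rewrite invr_gt0.
exact: orthogonal_trmx.
Qed.

Lemma dilates_similarity a T : 0 < a -> orthogonal_mx T ->
  dilates a (similarity a T).
Proof.
move=> a0 TT x y; rewrite /similarity -scalerBr -mulmxBl enormZ ?ltW//.
by rewrite /enorm dotv_ortho.
Qed.

Lemma cvg_similarity_coord a T x i j (F : set_system 'rV[R]_n) (FF : Filter F) :
  (forall k, (fun y : 'rV[R]_n => y i k) @ F --> x i k) ->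
  (fun y : 'rV[R]_n => a * \sum_k y i k * T k j : R) @ F -->
    (a * \sum_k x i k * T k j : R).
Proof.
move=> Fx; apply: cvgM; first exact: cvg_cst.
apply: cvg_big => [|k _]; first exact: add_continuous.
apply: cvgM; last exact: cvg_cst.
exact: Fx.
Qed.

Lemma continuous_similarity a T : continuous (similarity a T).
Proof.
move=> x A [P Px PA].
have FF : Filter (nbhs x) by typeclasses eauto.
have cP : \forall y \near x, forall ij : 'I_1 * 'I_n,
    P ij.1 ij.2 (similarity a T y ij.1 ij.2).
  apply: (@filter_forall _ _
    (fun ij y => P ij.1 ij.2 (similarity a T y ij.1 ij.2)) (nbhs x)) => -[i j] /=.
  have cij := @cvg_similarity_coord a T x i j (nbhs x) FF
    (fun k => @coord_continuous _ _ _ i k x).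
  have Pij := Px i j; rewrite !mxE in Pij.
  have E (y : 'rV[R]_n) : similarity a T y i j = a * \sum_k y i k * T k j by rewrite !mxE.
  under eq_near do rewrite E.
  exact: cij Pij.
apply: (filterS _ cP) => y Py.
by apply: PA => i j; exact: (Py (i, j)).
Qed.

Lemma image_similarity a T K : 0 < a -> orthogonal_mx T ->
  similarity a T @` K = similarity a^-1 T^T @^-1` K.
Proof.
move=> a0 TT; apply/seteqP; split=> [_ [x Kx <-] /=|x Kx /=].
  by rewrite similarityK.
by exists (similarity a^-1 T^T x) => //; rewrite similarityVK.
Qed.

Lemma similarity_image a T K x : 0 < a -> orthogonal_mx T ->
  (similarity a T @` K) (similarity a T x) <-> K x.
Proof. by move=> a0 TT; rewrite image_similarity//= similarityK. Qed.

(** The inverse is again a similarity, hence continuous too. *)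
Lemma nbhs_similarity a T x (A : set 'rV[R]_n) : 0 < a -> orthogonal_mx T ->
  nbhs (similarity a T x) A <-> nbhs x (similarity a T @^-1` A).
Proof.
move=> a0 TT; split=> [|nA]; first exact: continuous_similarity.
rewrite (_ : A = similarity a^-1 T^T @^-1` (similarity a T @^-1` A)).
  by apply: continuous_similarity; rewrite similarityK.
by apply/funext => y; rewrite /preimage /= similarityVK.
Qed.

Lemma bdry_similarity a T K x : 0 < a -> orthogonal_mx T ->
  bdry (similarity a T @` K) (similarity a T x) <-> bdry K x.
Proof.
move=> a0 TT; set f := similarity a T; set g := similarity a^-1 T^T.
have fK : f @^-1` (f @` K) = K.
  by apply/funext => y; apply/propext; exact: similarity_image.
have nP A : nbhs (f x) A <-> nbhs x (f @^-1` A) by exact: nbhs_similarity.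
split=> -[cK iK]; split.
- move=> A Ax; have /cK [_ [[y Ky <-] Ay]] : nbhs (f x) (g @^-1` A).
    by apply/nP; rewrite (_ : f @^-1` _ = A)//; apply/funext => y;
      rewrite /preimage /f /g /= similarityK.
  by exists y; split=> //; move: Ay; rewrite /f /g /= similarityK.
- by move=> xK; apply: iK; apply/nP; rewrite fK.
- by move=> A /nP /cK [y [Ky Ay]]; exists (f y); split=> //; exists y.
- by move=> /nP xK; apply: iK; rewrite fK in xK.
Qed.

Lemma dotv_similarity a T x u : orthogonal_mx T ->
  dotv (similarity a T x) (u *m T) = a * dotv x u.
Proof. by move=> TT; rewrite dotvZl dotv_ortho. Qed.

Lemma similarityB a T x y : similarity a T (x - y) = similarity a T x - similarity a T y.
Proof. by rewrite /similarity mulmxBl scalerBr. Qed.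

Lemma outer_unit_normal_similarity a T K x u : 0 < a -> orthogonal_mx T ->
  outer_unit_normal K x u ->
  outer_unit_normal (similarity a T @` K) (similarity a T x) (u *m T).
Proof.
move=> a0 TT [u1 Ku]; split; first by rewrite dotv_ortho.
move=> _ [y Ky <-]; rewrite -similarityB dotv_similarity//.
by rewrite pmulr_rle0// Ku.
Qed.

(** The ball inside K has the point x - r u + r w, which the second normal w
    keeps on its inner side: this forces <u, w> >= 1 for unit vectors u, w. *)
Lemma outer_unit_normal_unique K x u w r : 0 < r ->
  outer_unit_normal K x u -> eball (x - r *: u) r `<=` K ->
  outer_unit_normal K x w -> w = u.
Proof.
move=> r0 [u1 _] Kr [w1 Kw].
have : K (x - r *: u + r *: w).
  apply: Kr; rewrite /eball /= addrC addKr (enormZ _ (ltW r0)).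
  by rewrite /enorm w1 sqrtr1 mulr1.
have -> : x - r *: u + r *: w = x + r *: (w - u) by rewrite scalerBr -addrA (addrC (- _)).
move/Kw; rewrite addrC addKr dotvZl pmulr_rle0// dotvBl w1 subr_le0 => uw.
apply/eqP; rewrite -subr_eq0; apply/eqP/dotv_eq0/eqP.
rewrite eq_le dotv_ge0 andbT dotvBl !dotvBr w1 u1 (dotvC w); lra.
Qed.

Lemma normal_outer K x : inner_rolling_ball K -> bdry K x ->
  outer_unit_normal K x (normal K x).
Proof. by move=> [r _ Kr] /Kr [u Ku _]; exact: xgetI Ku. Qed.

Lemma normal_unique K x u : inner_rolling_ball K -> bdry K x ->
  outer_unit_normal K x u -> u = normal K x.
Proof.
move=> [r r0 Kr] /Kr [w Kw wK] Ku.
have Kn : outer_unit_normal K x (normal K x) by exact: xgetI Ku.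
by rewrite (outer_unit_normal_unique r0 Kw wK Ku) (outer_unit_normal_unique r0 Kw wK Kn).
Qed.

(** Uniqueness is used at x only: the normal of the image is pulled back to K
    and compared there with the normal of K. *)
Lemma normal_similarity a T K x : 0 < a -> orthogonal_mx T ->
  inner_rolling_ball K -> bdry K x ->
  normal (similarity a T @` K) (similarity a T x) = normal K x *m T.
Proof.
move=> a0 TT Ki Kx; set K' := _ @` K; set x' := similarity a T x.
have N' : outer_unit_normal K' x' (normal K' x').
  apply: xgetI (outer_unit_normal_similarity a0 TT (normal_outer Ki Kx)).
rewrite -(normal_unique Ki Kx (u := normal K' x' *m T^T)).
  by rewrite -mulmxA (mulmx1C TT) mulmx1.
have a'0 : 0 < a^-1 by rewrite invr_gt0.
have := outer_unit_normal_similarity a'0 (orthogonal_trmx TT) N'.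
rewrite similarityK// image_similarity//; last exact: orthogonal_trmx.
rewrite invrK trmxK; congr (outer_unit_normal _ _ _).
apply/funext => y /=; rewrite /K' image_similarity//= similarityK//.
Qed.

End similarity.

(** * Principal curvatures *)

Section curvature.
Context {R : realType} {n : nat}.
Implicit Types (x y u v w : 'rV[R]_n) (T : 'M[R]_n) (K : set 'rV[R]_n) (a : R).
Implicit Types (k : 'rV[R]_n.-1) (E : 'M[R]_(n.-1, n)).

(** The quadratic form on the tangent space whose half approximates the graph of
    the boundary; k holds its eigenvalues and the rows of E its axes. *)
Definition hessian_form k E v : R := \sum_i k 0 i * dotv v (row i E) ^+ 2.

Lemma hessian_formE k E v : hessian_form k E v = qform k (v *m E^T).
Proof. by apply: eq_bigr => i _; rewrite dotv_adjoint. Qed.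

Lemma hessian_formZ k E v (s : R) :
  hessian_form k E (s *: v) = s ^+ 2 * hessian_form k E v.
Proof.
rewrite /hessian_form big_distrr; apply: eq_bigr => i _ /=.
by rewrite dotvZl; ring.
Qed.

(** The condition under the quantifier on E in [is_principal_curvatures]: the
    frame is needed in the open to compare two choices. *)
Definition principal_frame K x k E :=
  [/\ E *m E^T = 1%:M, forall i, dotv (row i E) (normal K x) = 0 &
      forall e : R, 0 < e -> \forall v \near (0 : 'rV[R]_n),
        dotv v (normal K x) = 0 ->
        exists2 t, tangent_graph K x v t &
          `| t - 2^-1 * hessian_form k E v | <= e * enorm v ^+ 2].

Lemma principal_frameP K x k :
  is_principal_curvatures K x k <-> exists E, principal_frame K x k E.
Proof. by []. Qed.

Lemma tangent_graph_unique K x v (s t : R) :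
  tangent_graph K x v s -> tangent_graph K x v t -> s = t.
Proof.
by move=> [Ks Ms] [Kt Mt]; apply/eqP; rewrite eq_le Ms// Mt.
Qed.

(** K lies on the inner side of its supporting hyperplane at x. *)
Lemma tangent_graph_ge0 K x v (t : R) : outer_unit_normal K x (normal K x) ->
  dotv v (normal K x) = 0 -> tangent_graph K x v t -> 0 <= t.
Proof.
move=> [N1 KN] vN [/KN + _].
by rewrite -(addrA x) addrAC subrr add0r dotvBl dotvZl vN N1 mulr1 sub0r oppr_le0.
Qed.

(** The expansion along the ray through v, divided by s^2; the error bound no
    longer depends on s, so half the form at v is the limit of t / s^2. *)
Lemma principal_frame_ray K x k E v (e : R) : principal_frame K x k E ->
  dotv v (normal K x) = 0 -> 0 < e ->
  \forall s \near 0^'+, exists2 t, tangent_graph K x (s *: v) t &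
    `| t / s ^+ 2 - 2^-1 * hessian_form k E v | <= e * dotv v v.
Proof.
move=> [_ _ kE] vN e0.
have sv : s *: v @[s --> (0 : R)^'+] --> (0 : 'rV[R]_n).
  rewrite -[X in _ --> X](scale0r v); apply: cvgZ; last exact: cvg_cst.
  exact: cvg_at_right_filter.
near=> s.
have [|t Kt] : dotv (s *: v) (normal K x) = 0 ->
    exists2 t, tangent_graph K x (s *: v) t &
      `| t - 2^-1 * hessian_form k E (s *: v) | <= e * enorm (s *: v) ^+ 2.
- by near: s; exact: sv (kE _ e0).
- by rewrite dotvZl vN mulr0.
have s0 : 0 < s by near: s; exact: nbhs_right_gt.
have s20 : 0 < s ^+ 2 by rewrite exprn_gt0.
rewrite hessian_formZ (enormZ _ (ltW s0)) exprMn enorm_sqr => te.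
exists t => //; rewrite -(ler_pM2l s20) -{1}(gtr0_norm s20) -normrM.
rewrite mulrBr mulrCA divff ?gt_eqF// mulr1 (mulrCA _ 2^-1) (le_trans te)//.
by rewrite mulrCA.
Unshelve. all: by end_near. Qed.

(** Half of either form is within a small multiple of <v, v> of the same
    quotient t / s^2, as the graph over s v has only one height t. *)
Lemma hessian_form_unique K x k k' E E' v :
  principal_frame K x k E -> principal_frame K x k' E' ->
  dotv v (normal K x) = 0 -> hessian_form k E v = hessian_form k' E' v.
Proof.
move=> kE kE' vN; apply/eqP; rewrite -subr_eq0 -normr_le0; apply/ler_addgt0Pr => e e0.
rewrite add0r.
have v0 := dotv_ge0 v.
(* The + 1 keeps the denominator positive when v = 0. *)
set d := e / (4 * (dotv v v + 1)).
have d0 : 0 < d by rewrite divr_gt0// mulr_gt0//; lra.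
have dv : d * dotv v v <= e / 4.
  rewrite /d invfM mulrA -mulrA ler_piMr ?divr_ge0//; first exact: ltW.
  by rewrite mulrC ler_pdivrMr; lra.
have [s [s1 s2]] := filter_ex (filterI (principal_frame_ray kE vN d0)
  (principal_frame_ray kE' vN d0)).
case: s1 => t ts1; case: s2 => t' /(tangent_graph_unique ts1) <-.
rewrite !ler_distl => /andP[? ?] /andP[? ?]; lra.
Qed.

(** Along the i-th axis the quotients t / s^2 >= 0 approach k_i / 2. *)
Lemma principal_frame_ge0 K x k E i : outer_unit_normal K x (normal K x) ->
  principal_frame K x k E -> 0 <= k 0 i.
Proof.
move=> KN kE; have [EE EN _] := kE.
have rE j : dotv (row i E) (row j E) = (i == j)%:R.
  by rewrite dotv_adjoint -row_mul EE !mxE.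
have hk : hessian_form k E (row i E) = k 0 i.
  rewrite /hessian_form (bigD1 i)//= big1 ?addr0 => [|j ji]; rewrite rE ?eqxx.
    by rewrite expr1n mulr1.
  by rewrite eq_sym (negbTE ji) expr0n mulr0.
rewrite -[k 0 i]opprK oppr_ge0; apply/ler_addgt0Pr => e e0; rewrite add0r.
have e2 : 0 < e / 2 by rewrite divr_gt0.
have [s [t /(tangent_graph_ge0 KN) t0]] := filter_ex (principal_frame_ray kE (EN i) e2).
rewrite hk rE eqxx mulr1 ler_distl => /andP[? ?].
have : 0 <= t / s ^+ 2.
  by rewrite divr_ge0 ?sqr_ge0// t0// dotvZl EN mulr0.
lra.
Qed.

Lemma rows_orthogonal m (A : 'M[R]_(m, n)) u :
  (forall i, dotv (row i A) u = 0) -> A *m u^T = 0.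
Proof.
move=> Au; apply/matrixP => i j.
by rewrite ord1 [RHS]mxE -(Au i) dotvE -row_mul [RHS]mxE.
Qed.

(** n-1 orthonormal rows in the hyperplane orthogonal to the normal span it, so
    E^T E is the orthogonal projection onto that hyperplane. *)
Lemma frame_spans K x k E v : (0 < n)%N -> dotv (normal K x) (normal K x) = 1 ->
  principal_frame K x k E -> dotv v (normal K x) = 0 -> v *m E^T *m E = v.
Proof.
move=> n0 N1 [EE EN _] vN; set N := normal K x in N1 EN vN *.
have kerP m (A : 'M[R]_(m, n)) : (forall i, dotv (row i A) N = 0) -> (A <= kermx N^T)%MS.
  by move=> AN; apply/sub_kermxP; exact: rows_orthogonal.
have rkN : \rank N = 1%N.
  rewrite rank_rV; case: eqP N1 => // ->; rewrite dotvE mul0mx mxE => /eqP.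
  by rewrite eq_sym oner_eq0.
have rkE : \rank E = n.-1.
  by apply/eqP; apply/row_freeP; exists E^T.
have EkerE : (E == kermx N^T)%MS.
  have := (mxrank_leqif_eq (kerP _ E EN)).2.
  by rewrite rkE mxrank_ker mxrank_tr rkN subn1 eqxx.
have vE : (v <= E)%MS.
  rewrite (eqmxP EkerE); apply: kerP => i.
  by rewrite (_ : row i v = v)//; apply/rowP => j; rewrite mxE ord1.
by case/submxP: vE => D ->; rewrite -!mulmxA (mulmxA E) EE mul1mx.
Qed.

(** The two frames differ by the orthogonal matrix E E'^T, which turns one
    diagonal form into the other. *)
Lemma elem_sym_principal_curvatures K x k k' j : (0 < n)%N ->
  dotv (normal K x) (normal K x) = 1 ->
  is_principal_curvatures K x k -> is_principal_curvatures K x k' ->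
  elem_sym j k = elem_sym j k'.
Proof.
move=> n0 N1 /principal_frameP[E kE] /principal_frameP[E' kE'].
have [EE EN _] := kE.
have wN (w : 'rV_n.-1) : dotv (w *m E) (normal K x) = 0.
  by rewrite dotvE -mulmxA (rows_orthogonal EN) mulmx0 mxE.
apply: (@elem_sym_qform _ _ (E *m E'^T)).
  rewrite trmx_mul trmxK mulmxA.
  suff -> : E *m E'^T *m E' = E by [].
  apply/row_matrixP => i; rewrite !row_mul.
  exact: (frame_spans n0 N1 kE').
move=> w; rewrite -{1}[w]mulmx1 -EE !mulmxA -!hessian_formE.
exact: hessian_form_unique kE kE' _.
Qed.

(** If t = f(v) is the graph of K at x, then that of the image is
    t = a f(v / a) up to the rotation, whose Hessian is the one of f divided
    by a. *)
Lemma principal_frame_similarity a T K x k E : 0 < a -> orthogonal_mx T ->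
  normal (similarity a T @` K) (similarity a T x) = normal K x *m T ->
  principal_frame K x k E ->
  principal_frame (similarity a T @` K) (similarity a T x) (a^-1 *: k) (E *m T).
Proof.
move=> a0 TT NT [EE EN kE]; split.
- by rewrite trmx_mul mulmxA -(mulmxA E) TT mulmx1.
- by move=> i; rewrite NT row_mul dotv_ortho.
move=> e e0.
(* The bound a e for K becomes e after multiplication by a and division of
   the squared norm by a^2. *)
have ae0 : 0 < a * e by rewrite mulr_gt0.
have g0 : similarity a^-1 T^T (0 : 'rV[R]_n) = 0 by rewrite /similarity mul0mx scaler0.
have gcvg : similarity a^-1 T^T v @[v --> (0 : 'rV[R]_n)] --> (0 : 'rV[R]_n).
  by rewrite -[X in _ --> X]g0; exact: continuous_similarity.
near=> v; rewrite NT => vN; set w := similarity a^-1 T^T v.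
have H : dotv w (normal K x) = 0 -> exists2 t, tangent_graph K x w t &
    `| t - 2^-1 * hessian_form k E w | <= a * e * enorm w ^+ 2.
  by rewrite /w; near: v; exact: gcvg (kE _ ae0).
have vE : v = similarity a T w by rewrite similarityVK.
have wN : dotv w (normal K x) = 0.
  move: vN; rewrite vE dotv_similarity// => /eqP; rewrite mulf_eq0 gt_eqF//=.
  by move/eqP.
have [t [Kt tmin] tk] := H wN.
have graphE s : (similarity a T @` K)
    (similarity a T x + v - s *: (normal K x *m T)) <->
    K (x + w - (a^-1 * s) *: normal K x).
  rewrite -(similarity_image K _ a0 TT) similarityB vE.
  rewrite [similarity a T (x + w)]/similarity mulmxDl scalerDr.
  by rewrite [similarity a T (_ *: normal K x)]/similarity -scalemxAl scalerA mulVKf ?gt_eqF.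
exists (a * t).
  split; first by rewrite NT; apply/graphE; rewrite mulKf ?gt_eqF.
  move=> s; rewrite NT => /graphE /tmin.
  by rewrite ler_pdivlMl.
have -> : hessian_form (a^-1 *: k) (E *m T) v = a * hessian_form k E w.
  rewrite /hessian_form big_distrr; apply: eq_bigr => i _ /=.
  rewrite mxE row_mul vE dotv_similarity//.
  by field; rewrite gt_eqF.
rewrite mulrCA -mulrBr normrM (gtr0_norm a0) vE.
rewrite /similarity (enormZ _ (ltW a0)) exprMn.
have -> : enorm (w *m T) = enorm w by rewrite /enorm dotv_ortho.
apply: (@le_trans _ _ (a * (a * e * enorm w ^+ 2))); first by rewrite ler_pM2l.
by rewrite le_eqVlt; apply/orP; left; apply/eqP; ring.
Unshelve. all: by end_near. Qed.

End curvature.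

(** * Scaling of the quermassintegrals *)

Section quermassintegrals_similarity.
Context {R : realType} {n : nat}.
Implicit Types (x : 'rV[R]_n) (T : 'M[R]_n) (K : set 'rV[R]_n) (a p : R).

Lemma mean_curvatureE K j x : mean_curvature K j x =
  ('C(n.-1, j)%:R)^-1 * elem_sym j (principal_curvatures K x).
Proof. by []. Qed.

Lemma is_principal_curvatures_similarity a T K x k : 0 < a -> orthogonal_mx T ->
  normal (similarity a T @` K) (similarity a T x) = normal K x *m T ->
  is_principal_curvatures K x k ->
  is_principal_curvatures (similarity a T @` K) (similarity a T x) (a^-1 *: k).
Proof.
by move=> a0 TT NT [E kE]; exists (E *m T); exact: principal_frame_similarity.
Qed.

(** The image has curvatures exactly where K has them, as the inverse map is
    again a similarity; elsewhere the default value 0 gives H_j = 0 on both sides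
    because j > 0. *)
Lemma mean_curvature_similarity a T K x j : (0 < n)%N -> (0 < j)%N ->
  0 < a -> orthogonal_mx T -> inner_rolling_ball K -> bdry K x ->
  mean_curvature (similarity a T @` K) j (similarity a T x) =
  a^-1 ^+ j * mean_curvature K j x.
Proof.
move=> n0 j0 a0 TT Ki Kx; rewrite !mean_curvatureE mulrCA; congr (_ * _).
have NT := normal_similarity a0 TT Ki Kx.
set K' := _ @` K in NT *; set x' := similarity a T x in NT *.
have [N1 _] := normal_outer Ki Kx.
have [[k kK]|noK] := pselect (exists k, is_principal_curvatures K x k).
  have kK' := is_principal_curvatures_similarity a0 TT NT (xgetI 0 kK).
  rewrite -elem_symZ; apply: (elem_sym_principal_curvatures _ n0 _ _ kK').
    by rewrite NT dotv_ortho.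
  exact: xgetI kK'.
have -> : principal_curvatures K x = 0.
  by apply: xgetPN => k kK; apply: noK; exists k.
have -> : principal_curvatures K' x' = 0.
  apply: xgetPN => k kK'; apply: noK.
  have a'0 : 0 < a^-1 by rewrite invr_gt0.
  have gfK : similarity a^-1 T^T @` K' = K.
    rewrite image_similarity ?invrK ?trmxK//; last exact: orthogonal_trmx.
    apply/funext => y; apply/propext; exact: similarity_image.
  have gfx : similarity a^-1 T^T x' = x by rewrite /x' similarityK.
  exists (a^-1^-1 *: k); rewrite -gfK -gfx.
  apply: is_principal_curvatures_similarity => //; first exact: orthogonal_trmx.
  by rewrite gfK gfx NT -mulmxA TT mulmx1.
by rewrite elem_sym0// mulr0.
Qed.

Lemma mean_curvature_ge0 K x j : inner_rolling_ball K -> bdry K x ->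
  0 <= mean_curvature K j x.
Proof.
move=> Ki Kx; rewrite mean_curvatureE mulr_ge0 ?invr_ge0//.
apply: elem_sym_ge0 => i.
have [[k kK]|noK] := pselect (exists k, is_principal_curvatures K x k).
  have /principal_frameP[E] := xgetI 0 kK.
  exact: principal_frame_ge0 (normal_outer Ki Kx).
rewrite [principal_curvatures K x]xgetPN ?mxE// => k kK.
by apply: noK; exists k.
Qed.

(** The integrand of [steinerW], named to be transported pointwise. *)
Definition steiner_integrand p m k K x : R :=
  dotv x (normal K x) `^ (m%:R - k%:R + n%:R * (1 - p) / (n%:R + p)) *
     mean_curvature K n.-1 x `^ (p / (n%:R + p)) *
     \sum_(i : {ffun 'I_n.-1 -> 'I_m.+1} | (\sum_(j < n.-1) j.+1 * i j)%N == m)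
       (steiner_coef (n := n) p (fun j => i j) *
        \prod_(j < n.-1)
          ('C(n.-1, j.+1)%:R ^+ i j * mean_curvature K j.+1 x ^+ i j)).

(** The division by a^(n-1) compensates the scaling of the surface measure. *)
Lemma steiner_integrand_similarity a T K x p m k : (2 <= n)%N -> n%:R + p != 0 ->
  0 < a -> orthogonal_mx T -> convex_body_o K -> inner_rolling_ball K -> bdry K x ->
  steiner_integrand p m k (similarity a T @` K) (similarity a T x) =
  a `^ (n%:R * ((n%:R - p) / (n%:R + p)) - k%:R) / a ^+ n.-1 *
    steiner_integrand p m k K x.
Proof.
move=> n2 np a0 TT [_ _ K0] Ki Kx; rewrite /steiner_integrand.
have n0 : (0 < n)%N by exact: leq_trans n2.
have n1 : (0 < n.-1)%N by rewrite -ltnS prednK.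
have [_ KN] := normal_outer Ki Kx.
(* The origin lies in K, hence on the inner side of the tangent hyperplane;
   the real powers are multiplicative on nonnegative numbers. *)
have h0 : 0 <= dotv x (normal K x).
  by have := KN 0 (interior_subset K0); rewrite sub0r dotvNl oppr_le0.
have Hj j : (0 < j)%N -> mean_curvature (similarity a T @` K) j (similarity a T x) =
    a^-1 ^+ j * mean_curvature K j x by move=> j0; exact: mean_curvature_similarity.
rewrite (normal_similarity a0 TT Ki Kx) dotv_similarity// Hj//.
rewrite powRM ?(ltW a0)// powRM ?exprn_ge0 ?invr_ge0 ?(ltW a0) ?mean_curvature_ge0//.
have -> : \sum_(i : {ffun 'I_n.-1 -> 'I_m.+1} | (\sum_(j < n.-1) j.+1 * i j)%N == m)
       (steiner_coef (n := n) p (fun j => i j) *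
        \prod_(j < n.-1) ('C(n.-1, j.+1)%:R ^+ i j *
          mean_curvature (similarity a T @` K) j.+1 (similarity a T x) ^+ i j)) =
    a^-1 ^+ m * \sum_(i : {ffun 'I_n.-1 -> 'I_m.+1} | (\sum_(j < n.-1) j.+1 * i j)%N == m)
       (steiner_coef (n := n) p (fun j => i j) *
        \prod_(j < n.-1)
          ('C(n.-1, j.+1)%:R ^+ i j * mean_curvature K j.+1 x ^+ i j)).
  rewrite big_distrr; apply: eq_bigr => i /eqP im /=.
  rewrite mulrCA; congr (_ * _).
  rewrite -(congr1 (fun l => a^-1 ^+ l) im) /= expr_sum -big_split /=.
  apply: eq_bigr => j _.
  by rewrite Hj// exprMn -exprM mulrCA.
set S := \sum_(i | _) _.
set e := _ - k%:R + _; set q := p / _.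
have -> : a `^ (n%:R * ((n%:R - p) / (n%:R + p)) - k%:R) / a ^+ n.-1 =
    a `^ e * (a^-1 ^+ n.-1) `^ q * a^-1 ^+ m.
  have aN : a^-1 = a `^ (-1) by rewrite powR_inv1// ltW.
  have aNn l : a^-1 ^+ l = a `^ (- l%:R).
    by rewrite aN -powR_mulrn ?powR_ge0// -powRrM mulN1r.
  have aI : a ^- n.-1 = a^-1 ^+ n.-1 by rewrite exprVn.
  have an0 : a != 0 by rewrite gt_eqF.
  rewrite aI !aNn -powRrM -!powRD ?an0 ?implybT//; congr (_ `^ _).
  rewrite /e /q -subn1 natrB//.
  by field.
ring.
Qed.

End quermassintegrals_similarity.

Section measurability.
Context {R : realType} {n : nat}.

Lemma measurable_similarity (a : R) (T : 'M[R]_n) d : 0 < a -> orthogonal_mx T ->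
  measurable_fun setT (similarity a T : caratheodory_type (@hausdorff R n d) ->
                       caratheodory_type (@hausdorff R n d)).
Proof.
move=> a0 TT _ A mA; rewrite setTI.
have a'0 : 0 < a^-1 by rewrite invr_gt0.
apply: (caratheodory_dilates a'0 (similarityVK a0 TT) (similarityK a0 TT)) => //.
exact: dilates_similarity (orthogonal_trmx TT).
Qed.

Lemma hausdorff_measure_similarity (a : R) (T : 'M[R]_n) d
    (A : set (caratheodory_type (@hausdorff R n d))) : 0 < a -> orthogonal_mx T ->
  hausdorff_measure R n d (similarity a^-1 T^T @^-1` A) =
  ((a ^+ d)%:E * hausdorff_measure R n d A)%E.
Proof.
move=> a0 TT; exact: (hausdorff_dilates _ A a0 (similarityK a0 TT)
  (similarityVK a0 TT) (dilates_similarity a0 TT)).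
Qed.

Lemma hausdorff_Rintegral_similarity (a b : R) (T : 'M[R]_n) d (D' D : set 'rV[R]_n)
    (F G : 'rV[R]_n -> R) : 0 < a -> orthogonal_mx T -> 0 < b ->
  (forall x, D' (similarity a T x) <-> D x) ->
  (forall x, D x -> F (similarity a T x) = b * G x) ->
  \int[hausdorff_measure R n d]_(x in D') F x =
  a ^+ d * b * \int[hausdorff_measure R n d]_(x in D) G x.
Proof.
move=> a0 TT b0 DD FG.
have a'0 : 0 < a^-1 by rewrite invr_gt0.
have ad0 : 0 < a ^+ d by rewrite exprn_gt0.
exact (@Rintegral_bijection _ _ R (hausdorff_measure R n d)
  (similarity a T) (similarity a^-1 T^T) (a ^+ d) b D' D F G
  (similarityK a0 TT) (similarityVK a0 TT)
  (measurable_similarity a0 TT) (measurable_similarity a'0 (orthogonal_trmx TT))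
  ad0 b0 (fun A _ => hausdorff_measure_similarity A a0 TT) DD FG).
Qed.

(** The scaling rule announced above; the factors a^(n-1) of the measure and
    a^-(n-1) of the integrand cancel. *)
Lemma steinerW_similarity (a p : R) (T : 'M[R]_n) (K : set 'rV[R]_n) m k : (2 <= n)%N ->
  n%:R + p != 0 -> 0 < a -> orthogonal_mx T -> class_C K ->
  steinerW p m k (similarity a T @` K) =
  a `^ (n%:R * ((n%:R - p) / (n%:R + p)) - k%:R) * steinerW p m k K.
Proof.
move=> n2 np a0 TT [Ko Ki _].
have WE K' : steinerW p m k K' =
  \int[hausdorff_measure R n n.-1]_(x in bdry K') steiner_integrand p m k K' x by [].
rewrite !WE; set b := a `^ _.
have an0 : 0 < a ^+ n.-1 by rewrite exprn_gt0.
have b0 : 0 < b / a ^+ n.-1 by rewrite divr_gt0// powR_gt0.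
have -> := hausdorff_Rintegral_similarity n.-1 a0 TT b0
  (fun x => bdry_similarity K x a0 TT)
  (fun x => steiner_integrand_similarity m k n2 np a0 TT Ko Ki).
by rewrite (mulrCA (a ^+ n.-1)) divff ?mulr1// gt_eqF.
Qed.

Lemma steinerV_similarity (a p : R) (T : 'M[R]_n) (K : set 'rV[R]_n) k : (2 <= n)%N ->
  n%:R + p != 0 -> 0 < a -> orthogonal_mx T -> class_C K ->
  steinerV p k (similarity a T @` K) =
  a `^ (n%:R * ((n%:R - p) / (n%:R + p)) - k%:R) * steinerV p k K.
Proof.
move=> n2 np a0 TT KC; rewrite /steinerV big_distrr; apply: eq_bigr => m _ /=.
by rewrite steinerW_similarity// mulrCA.
Qed.

End measurability.

Theorem theorem1 (R : realType) (n : nat) (hn : (2 <= n)%N)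
    (K : set 'rV[R]_n) (hK : class_C K)
    (p : R) (hp : 0 <= p \/ p < - n%:R)
    (k m : nat) (hk : (0 < k)%N) :
  (forall a : R, 0 < a ->
     steinerW p m k [set a *: x | x in K] =
       a `^ (n%:R * ((n%:R - p) / (n%:R + p)) - k%:R) * steinerW p m k K /\
     steinerV p k [set a *: x | x in K] =
       a `^ (n%:R * ((n%:R - p) / (n%:R + p)) - k%:R) * steinerV p k K) /\
  (forall T : 'M[R]_n, T *m T^T = 1%:M ->
     steinerW p m k [set x *m T | x in K] = steinerW p m k K /\
     steinerV p k [set x *m T | x in K] = steinerV p k K).
Proof.
have np : n%:R + p != 0.
  have n0 : (0 < n%:R :> R) by rewrite ltr0n (leq_trans _ hn).
  by case: hp => p0; [rewrite gt_eqF//|rewrite lt_eqF//]; lra.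
split=> [a a0|T TT].
  have -> : [set a *: x | x in K] = similarity a 1%:M @` K.
    by apply: eq_imagel => x _; rewrite /similarity mulmx1.
  have I1 : orthogonal_mx (1%:M : 'M[R]_n) by rewrite /orthogonal_mx trmx1 mulmx1.
  by split; [exact: steinerW_similarity|exact: steinerV_similarity].
have -> : [set x *m T | x in K] = similarity 1 T @` K.
  by apply: eq_imagel => x _; rewrite /similarity scale1r.
split.
  by have := steinerW_similarity m k hn np ltr01 TT hK; rewrite powR1 mul1r.
by have := steinerV_similarity k hn np ltr01 TT hK; rewrite powR1 mul1r.
Qed.
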